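(* For $w\in S_n$ with Rothe diagram $D(w)$, \begin{align*} r_1(D(w))+r_2(D(w))+r_3(D(w))\ \ge\ & p_{132}(w)+p_{1432}(w)+p_{13254}(w)+3p_{14253}(w)+p_{14352}(w)+4p_{15243}(w)\\ &+p_{15324}(w)+2p_{15342}(w)+p_{15432}(w)+p_{24153}(w)+2p_{25143}(w)+p_{35142}(w). \end{align*}
   Context: The Rothe diagram of $w\in S_n$ is $D(w)=\{(i,j)\in[n]\times[n]: j<w(i),\ i<w^{-1}(j)\}$, where $(i,j)$ is the box in row $i$ (rows numbered top to bottom) and column $j$. For a diagram $D$: $r_1(D)$ is the number of pairs of boxes $\{(i_1,j),(i_2,j)\}$ with $i_1<i_2$, $(i_1,j)\notin D$, $(i_2,j)\in D$; $r_2(D)$ is the number of 6-box sets $\{i_1,i_2,i_3\}\times\{j_1,j_2\}$ with $i_1<i_2<i_3$, $j_1<j_2$ such that either exactly $(i_2,j_1),(i_2,j_2),(i_3,j_1)$ among them lie in $D$, or exactly $(i_2,j_1),(i_2,j_2),(i_3,j_2)$ among them lie in $D$; $r_3(D)$ is the number of 4-box sets $\{(i_1,a),(i_2,a),(i_3,b),(i_4,b)\}$ with $i_1<i_2<i_3<i_4$ (with $a<b$, $a>b$ or $a=b$) such that $(i_1,a),(i_3,b)\notin D$ and $(i_2,a),(i_4,b)\in D$. For $u\in S_m$, $p_u(w)$ is the number of subsequences $w(i_1)\cdots w(i_m)$, $i_1<\cdots<i_m$, having the same relative order as $u$. *)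

(* Defs.v *)
From mathcomp Require Import all_boot all_fingroup.

Set Implicit Arguments.
Unset Strict Implicit.
Unset Printing Implicit Defensive.

(* Rows, columns and values are numbered from 0, as elements of 'I_n, instead
   of from 1; only their relative order matters below.  The box in row i and
   column j is the pair (i, j). *)

Definition rothe (n : nat) (w : 'S_n) : {set 'I_n * 'I_n} :=
  [set b : 'I_n * 'I_n | (b.2 < w b.1) && (b.1 < (w^-1)%g b.2)].

(* The strict inequalities on the indices make each set of boxes counted by
   r1, r2, r3 correspond to exactly one tuple of row and column indices, so the
   box sets are counted through these tuples. *)

Definition r1 (n : nat) (D : {set 'I_n * 'I_n}) : nat :=
  #|[set t : 'I_n * 'I_n * 'I_n |
      let: (i1, i2, j) := t in
      [&& i1 < i2, (i1, j) \notin D & (i2, j) \in D]]|.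

Definition r2 (n : nat) (D : {set 'I_n * 'I_n}) : nat :=
  #|[set t : 'I_n * 'I_n * 'I_n * 'I_n * 'I_n |
      let: (i1, i2, i3, j1, j2) := t in
      [&& i1 < i2, i2 < i3, j1 < j2 &
        [&& (i1, j1) \notin D, (i1, j2) \notin D,
            (i2, j1) \in D,    (i2, j2) \in D,
            (i3, j1) \in D   & (i3, j2) \notin D]
        || [&& (i1, j1) \notin D, (i1, j2) \notin D,
               (i2, j1) \in D,    (i2, j2) \in D,
               (i3, j1) \notin D & (i3, j2) \in D]]]|.

Definition r3 (n : nat) (D : {set 'I_n * 'I_n}) : nat :=
  #|[set t : 'I_n * 'I_n * 'I_n * 'I_n * 'I_n * 'I_n |
      let: (i1, i2, i3, i4, a, b) := t in
      [&& i1 < i2, i2 < i3, i3 < i4,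
          (i1, a) \notin D, (i2, a) \in D,
          (i3, b) \notin D & (i4, b) \in D]]|.

(* The pattern u in S_m is given by its one-line notation, a word of length m;
   a subsequence of w is given by its increasing sequence f of positions. *)

Definition pattern_count (u : seq nat) (n : nat) (w : 'S_n) : nat :=
  #|[set f : {ffun 'I_(size u) -> 'I_n} |
      [forall a : 'I_(size u), forall b : 'I_(size u), (a < b) ==> (f a < f b)] &&
      [forall a : 'I_(size u), forall b : 'I_(size u),
         (w (f a) < w (f b)) == (nth 0 u a < nth 0 u b)]]|.

(* Main.v *)
Require Import Defs.
From mathcomp Require Import all_boot all_fingroup.
From mathcomp Require Import zify.

(* Write each column as [j = w k].  Then [(i, w k)] lies in the Rothe diagram iff
   [i < k] and [w k < w i], so r1 counts exactly the occurrences of 132.  A tuple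
   [(i1, i2, i3, w a, w b)] counted by r2 is an occurrence of 1432 if [b = i3];
   otherwise it selects five increasing positions, in one of four ways according
   to the order of [i3], [a], [b].  A tuple [(i1, i2, i3, i4, w a, w b)] counted
   by r3 involves only the five positions [i1 < i2 < i3 < i4 < b] if [a] is [i3],
   [i4] or [b].  Summing over increasing 5-tuples of positions, it is enough to
   compare, for each 5-tuple, the patterns with these seven shapes; the r3-tuples
   with six distinct positions are what the inequality discards. *)

Set Implicit Arguments.
Unset Strict Implicit.
Unset Printing Implicit Defensive.

Lemma leq_card_inj_in (T U : finType) (g : T -> U) (A : {set T}) (B : {set U}) :
  {in A &, injective g} -> {in A, forall x, g x \in B} -> #|A| <= #|B|.
Proof.
move=> injg gAB; rewrite -(card_in_imset injg); apply: subset_leq_card.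
by apply/subsetP=> _ /imsetP[x xA ->]; exact: gAB.
Qed.

(** The double sum counts the pairs [(x, i)] with [g i x] in [B], and the joint injectivity of [g]
    embeds them in [B]. *)
Lemma leq_sum_preim (I T U : finType) (g : I -> T -> U)
    (A : {set T}) (B : {set U}) :
  (forall i j, {in A &, forall x y, g i x = g j y -> i = j /\ x = y}) ->
  \sum_(x in A) \sum_i (g i x \in B) <= #|B|.
Proof.
move=> injg.
have -> : \sum_(x in A) \sum_i (g i x \in B)
          = #|[set p : T * I | (p.1 \in A) && (g p.2 p.1 \in B)]|.
  rewrite pair_big_dep -sum1dep_card [RHS]big_mkcondr /=.
  by apply: eq_big => [p|p _]; rewrite ?andbT //; case: (_ \in B).
apply: (@leq_card_inj_in _ _ (fun p => g p.2 p.1)); last first.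
  by move=> p; rewrite inE => /andP[].
move=> [x i] [y j]; rewrite !inE /= => /andP[xA _] /andP[yA _].
by case/(injg _ _ _ _ xA yA) => -> ->.
Qed.

(** For distinct entries this list encodes the relative order, so matching a pattern becomes an
    equality test. *)
Fixpoint comparisons (s : seq nat) : seq bool :=
  if s is x :: s' then [seq x < y | y <- s'] ++ comparisons s' else [::].

Section Permutation.

Variables (n : nat) (w : 'S_n).
Implicit Types i k p q : 'I_n.

Lemma mem_rothe i k : ((i, w k) \in rothe w) = (i < k) && (w k < w i).
Proof. by rewrite inE /= permK andbC. Qed.

Definition increasing5 :=
  [set t : 'I_n * 'I_n * 'I_n * 'I_n * 'I_n | let: (p0, p1, p2, p3, p4) := t in
    [&& p0 < p1, p1 < p2, p2 < p3 & p3 < p4]].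

Definition comparisons5 (t : 'I_n * 'I_n * 'I_n * 'I_n * 'I_n) : seq bool :=
  let: (p0, p1, p2, p3, p4) := t in
  comparisons [:: val (w p0); val (w p1); val (w p2); val (w p3); val (w p4)].

Definition occurrences (u : seq nat) :=
  [set f : {ffun 'I_(size u) -> 'I_n} |
    [forall a : 'I_(size u), forall b : 'I_(size u), (a < b) ==> (f a < f b)] &&
    [forall a : 'I_(size u), forall b : 'I_(size u),
       (w (f a) < w (f b)) == (nth 0 u a < nth 0 u b)]].

Lemma occurrenceP (u : seq nat) (f : {ffun 'I_(size u) -> 'I_n}) :
  f \in occurrences u ->
  (forall a b : 'I_(size u), a < b -> f a < f b)
  /\ (forall a b : 'I_(size u), (w (f a) < w (f b)) = (nth 0 u a < nth 0 u b)).
Proof.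
rewrite inE => /andP[incf occf]; split=> a b.
  exact: (implyP (forallP (forallP incf a) b)).
exact: eqP (forallP (forallP occf a) b).
Qed.

Notation o m k := (@Ordinal m k isT) (only parsing).

Lemma pattern_count5 a b c d e :
  pattern_count [:: a; b; c; d; e] w
  <= \sum_(t in increasing5) (comparisons5 t == comparisons [:: a; b; c; d; e]).
Proof.
set u := [:: a; b; c; d; e].
have -> : \sum_(t in increasing5) (comparisons5 t == comparisons u)
    = #|[set t in increasing5 | comparisons5 t == comparisons u]|.
  rewrite -sum1dep_card big_mkcondr /=; apply: eq_bigr => t _.
  by case: (_ == _).
apply: (@leq_card_inj_in _ _ (fun f : {ffun 'I_5 -> 'I_n} =>
  (f (o 5 0), f (o 5 1), f (o 5 2), f (o 5 3), f (o 5 4)))).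
  move=> f g _ _ [E0 E1 E2 E3 E4]; apply/ffunP => -[[|[|[|[|[|//]]]]] lt_k];
    by rewrite (bool_irrelevance lt_k isT).
move=> f /(@occurrenceP u f)[incf occf].
rewrite !inE !incf //=; apply/eqP.
by rewrite !occf.
Qed.

Lemma pattern_count132_leq : pattern_count [:: 1; 3; 2] w <= r1 (rothe w).
Proof.
apply: (@leq_card_inj_in _ _ (fun f : {ffun 'I_3 -> 'I_n} =>
  (f (o 3 0), f (o 3 1), w (f (o 3 2))))).
  move=> f g _ _ [E0 E1 /perm_inj E2]; apply/ffunP => -[[|[|[|//]]] lt_k];
    by rewrite (bool_irrelevance lt_k isT).
move=> f /(@occurrenceP [:: 1; 3; 2] f)[incf occf].
by rewrite inE !mem_rothe !incf // !occf.
Qed.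

Definition r2_set :=
  [set t : 'I_n * 'I_n * 'I_n * 'I_n * 'I_n | let: (i1, i2, i3, j1, j2) := t in
      [&& i1 < i2, i2 < i3, j1 < j2 &
        [&& (i1, j1) \notin rothe w, (i1, j2) \notin rothe w,
            (i2, j1) \in rothe w,    (i2, j2) \in rothe w,
            (i3, j1) \in rothe w   & (i3, j2) \notin rothe w]
        || [&& (i1, j1) \notin rothe w, (i1, j2) \notin rothe w,
               (i2, j1) \in rothe w,    (i2, j2) \in rothe w,
               (i3, j1) \notin rothe w & (i3, j2) \in rothe w]]].

Definition r3_set :=
  [set t : 'I_n * 'I_n * 'I_n * 'I_n * 'I_n * 'I_n |
    let: (i1, i2, i3, i4, a, b) := t in
      [&& i1 < i2, i2 < i3, i3 < i4,
          (i1, a) \notin rothe w, (i2, a) \in rothe w,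
          (i3, b) \notin rothe w & (i4, b) \in rothe w]].

(** With [j2 = w b] this is the case [b = i3]; it keeps the 1432 occurrences apart from the tuples
    on five positions. *)
Definition corner_in_row3 :=
  [set t : 'I_n * 'I_n * 'I_n * 'I_n * 'I_n |
    let: (_, _, i3, _, j2) := t in j2 == w i3].

Lemma pattern_count1432_leq :
  pattern_count [:: 1; 4; 3; 2] w <= #|r2_set :&: corner_in_row3|.
Proof.
apply: (@leq_card_inj_in _ _ (fun f : {ffun 'I_4 -> 'I_n} =>
  (f (o 4 0), f (o 4 1), f (o 4 2), w (f (o 4 3)), w (f (o 4 2))))).
  move=> f g _ _ [E0 E1 E2 /perm_inj E3 _]; apply/ffunP => -[[|[|[|[|//]]]] lt_k];
    by rewrite (bool_irrelevance lt_k isT).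
move=> f /(@occurrenceP [:: 1; 4; 3; 2] f)[incf occf].
rewrite in_setI [X in _ && X]inE eqxx andbT.
by rewrite inE !mem_rothe !ltnn !incf // !occf.
Qed.

(** In turn: [b < i3 < a], [i3 < b < a], [i3 < a < b], [a < i3 < b]. Row [i3] meets the diagram in
    one of the two columns, so [i3] is never last. *)
Definition r2_map (m : 'I_4) (t : 'I_n * 'I_n * 'I_n * 'I_n * 'I_n) :=
  let: (p0, p1, p2, p3, p4) := t in
  match val m with
  | 0 => (p0, p1, p3, w p4, w p2)
  | 1 => (p0, p1, p2, w p4, w p3)
  | 2 => (p0, p1, p2, w p3, w p4)
  | _ => (p0, p1, p3, w p2, w p4)
  end.

Definition r3_map (m : 'I_3) (t : 'I_n * 'I_n * 'I_n * 'I_n * 'I_n) :=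
  let: (p0, p1, p2, p3, p4) := t in
  match val m with
  | 0 => (p0, p1, p2, p3, w p2, w p4)
  | 1 => (p0, p1, p2, p3, w p3, w p4)
  | _ => (p0, p1, p2, p3, w p4, w p4)
  end.

(** The order of [i3], [a], [b] in the image gives back the shape. *)
Lemma r2_map_inj (i j : 'I_4) : {in increasing5 &, forall x y,
  r2_map i x = r2_map j y -> i = j /\ x = y}.
Proof.
move=> [[[[p0 p1] p2] p3] p4] [[[[q0 q1] q2] q3] q4]; rewrite !inE.
move=> /and4P[Hp1 Hp2 Hp3 Hp4] /and4P[Hq1 Hq2 Hq3 Hq4].
case: i j => [[|[|[|[|//]]]] ?] [[|[|[|[|//]]]] ?] /= [];
  move=> ? ? ? /perm_inj ? /perm_inj ?; subst;
  try (split; [exact: val_inj | by []]); exfalso; lia.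
Qed.

(** The shape is read off from which of [i3], [i4], [b] equals [a]. *)
Lemma r3_map_inj (i j : 'I_3) : {in increasing5 &, forall x y,
  r3_map i x = r3_map j y -> i = j /\ x = y}.
Proof.
move=> [[[[p0 p1] p2] p3] p4] [[[[q0 q1] q2] q3] q4]; rewrite !inE.
move=> /and4P[Hp1 Hp2 Hp3 Hp4] /and4P[Hq1 Hq2 Hq3 Hq4].
case: i j => [[|[|[|//]]] ?] [[|[|[|//]]] ?] /= [];
  move=> ? ? ? ? /perm_inj ? /perm_inj ?; subst;
  try (split; [exact: val_inj | by []]); exfalso; lia.
Qed.

Lemma r2_lower :
  pattern_count [:: 1; 4; 3; 2] w
  + \sum_(t in increasing5) \sum_i (r2_map i t \in r2_set) <= r2 (rothe w).
Proof.
rewrite /r2 -/r2_set -(cardsID corner_in_row3 r2_set) leq_add ?pattern_count1432_leq //.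
apply: leq_trans (leq_sum_preim _ r2_map_inj).
apply: leq_sum => -[[[[p0 p1] p2] p3] p4].
rewrite inE => /and4P[_ _ lt23 lt34]; have lt24 := ltn_trans lt23 lt34.
(* In all four shapes [b] and [i3] are distinct positions, so the image avoids [corner_in_row3]. *)
apply: leq_sum => -[[|[|[|[|//]]]] ?] _ /=;
  rewrite in_setD [_ \in corner_in_row3]inE (inj_eq perm_inj) -val_eqE neq_ltn /=;
  by rewrite ?lt23 ?lt24 ?lt34 ?orbT.
Qed.

Lemma r3_lower :
  \sum_(t in increasing5) \sum_i (r3_map i t \in r3_set) <= r3 (rothe w).
Proof. exact: leq_sum_preim _ r3_map_inj. Qed.

(** At most one of the ten tests holds, so the claim is that each coefficient is at most the number
    of the seven shapes its pattern realizes. *)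
Lemma leq_comparisons5 t : t \in increasing5 ->
  (comparisons5 t == comparisons [:: 1; 3; 2; 5; 4])
  + 3 * (comparisons5 t == comparisons [:: 1; 4; 2; 5; 3])
  + (comparisons5 t == comparisons [:: 1; 4; 3; 5; 2])
  + 4 * (comparisons5 t == comparisons [:: 1; 5; 2; 4; 3])
  + (comparisons5 t == comparisons [:: 1; 5; 3; 2; 4])
  + 2 * (comparisons5 t == comparisons [:: 1; 5; 3; 4; 2])
  + (comparisons5 t == comparisons [:: 1; 5; 4; 3; 2])
  + (comparisons5 t == comparisons [:: 2; 4; 1; 5; 3])
  + 2 * (comparisons5 t == comparisons [:: 2; 5; 1; 4; 3])
  + (comparisons5 t == comparisons [:: 3; 5; 1; 4; 2])
  <= \sum_i (r2_map i t \in r2_set) + \sum_i (r3_map i t \in r3_set).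
Proof.
case: t => [[[[p0 p1] p2] p3] p4]; rewrite inE => /and4P[lt01 lt12 lt23 lt34].
have gtw p q : p < q -> (w q < w p) = ~~ (w p < w q).
  move=> lt_pq; rewrite ltn_neqAle -leqNgt andb_idl // => _.
  by rewrite (inj_eq val_inj) (inj_eq perm_inj) -val_eqE /= gtn_eqF.
have lt02 := ltn_trans lt01 lt12; have lt13 := ltn_trans lt12 lt23.
have lt24 := ltn_trans lt23 lt34; have lt03 := ltn_trans lt02 lt23.
have lt14 := ltn_trans lt12 lt24; have lt04 := ltn_trans lt01 lt14.
(* Two shapes of [r2_map] test row [p3] in the column of [p2]; that box is outside the diagram. *)
have gt23 : (p3 < p2) = false by rewrite ltnNge ltnW.
rewrite !big_ord_recl !big_ord0 /= !inE /= !permK.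
rewrite !(gtw _ _ lt01, gtw _ _ lt02, gtw _ _ lt03, gtw _ _ lt04, gtw _ _ lt12,
  gtw _ _ lt13, gtw _ _ lt14, gtw _ _ lt23, gtw _ _ lt24, gtw _ _ lt34).
rewrite !(gt23, lt01, lt02, lt03, lt04, lt12, lt13, lt14, lt23, lt24,
  lt34) /=.
(* The patterns and the shapes are now Boolean functions of the ten comparisons
   [w p_a < w p_b], and the inequality holds for all their values, including
   those that violate transitivity. *)
case: (w p0 < w p1); case: (w p0 < w p2); case: (w p0 < w p3);
case: (w p0 < w p4); case: (w p1 < w p2); case: (w p1 < w p3);
case: (w p1 < w p4); case: (w p2 < w p3); case: (w p2 < w p4);
by case: (w p3 < w p4).
Qed.

End Permutation.

Theorem theorem4p1 (n : nat) (w : 'S_n) :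
  pattern_count [:: 1; 3; 2] w
  + pattern_count [:: 1; 4; 3; 2] w
  + pattern_count [:: 1; 3; 2; 5; 4] w
  + 3 * pattern_count [:: 1; 4; 2; 5; 3] w
  + pattern_count [:: 1; 4; 3; 5; 2] w
  + 4 * pattern_count [:: 1; 5; 2; 4; 3] w
  + pattern_count [:: 1; 5; 3; 2; 4] w
  + 2 * pattern_count [:: 1; 5; 3; 4; 2] w
  + pattern_count [:: 1; 5; 4; 3; 2] w
  + pattern_count [:: 2; 4; 1; 5; 3] w
  + 2 * pattern_count [:: 2; 5; 1; 4; 3] w
  + pattern_count [:: 3; 5; 1; 4; 2] w
  <= r1 (rothe w) + r2 (rothe w) + r3 (rothe w).
Proof.
have := @leq_sum _ (index_enum _) _ _ _ (@leq_comparisons5 n w).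
(* [big_split] also splits the products by numerals, which unfold to sums
   ending in [0]; this explains [big1_eq]. *)
rewrite !big_split /= !big1_eq.
move: (pattern_count132_leq w) (r2_lower w) (r3_lower w).
move: (pattern_count5 w 1 3 2 5 4) (pattern_count5 w 1 4 2 5 3)
  (pattern_count5 w 1 4 3 5 2) (pattern_count5 w 1 5 2 4 3)
  (pattern_count5 w 1 5 3 2 4) (pattern_count5 w 1 5 3 4 2)
  (pattern_count5 w 1 5 4 3 2) (pattern_count5 w 2 4 1 5 3)
  (pattern_count5 w 2 5 1 4 3) (pattern_count5 w 3 5 1 4 2).
(* Once the comparison lists are computed, the bounds are linear in the same sums. *)
rewrite /=; lia.
Qed.
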